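(* Let $A\in\mathbb{R}^{m\times n}$ (source matrix), $B\in\mathbb{R}^{m\times r}$ (target matrix), and let $\mathcal{S}\subseteq\{1,\dots,n\}$ be a set of column indices such that the columns of $A_{:\mathcal{S}}$ are linearly independent. For any $\mathcal{P}\subset\mathcal{S}$, let $\mathcal{R}=\mathcal{S}\setminus\mathcal{P}$, $E=A-P^{(\mathcal{P})}A$, $F=B-P^{(\mathcal{P})}B$, and $R^{(\mathcal{R})}=E_{:\mathcal{R}}\left(E_{:\mathcal{R}}^{T}E_{:\mathcal{R}}\right)^{-1}E_{:\mathcal{R}}^{T}$ (the projection onto the span of the columns of $E$ indexed by $\mathcal{R}$). Then $$\mathbf{F}(\mathcal{S})=\mathbf{F}(\mathcal{P})-\left\Vert R^{(\mathcal{R})}F\right\Vert_{F}^{2}.$$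
   Context: For a matrix $M$ and an index set $\mathcal{T}$, $M_{:\mathcal{T}}$ denotes the submatrix of $M$ consisting of the columns indexed by $\mathcal{T}$. For a set $\mathcal{T}$ of column indices of $A$ with $A_{:\mathcal{T}}$ of full column rank, $P^{(\mathcal{T})}=A_{:\mathcal{T}}\left(A_{:\mathcal{T}}^{T}A_{:\mathcal{T}}\right)^{-1}A_{:\mathcal{T}}^{T}$ is the orthogonal projection onto the span of those columns (with $P^{(\emptyset)}=0$). The column subset selection criterion is $\mathbf{F}(\mathcal{T})=\|B-P^{(\mathcal{T})}B\|_{F}^{2}$, where $\|\cdot\|_F$ is the Frobenius norm. *)

(* Defs.v *)
From mathcomp Require Export all_boot all_order all_algebra.
From mathcomp Require Export reals.

Set Implicit Arguments.
Unset Strict Implicit.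
Unset Printing Implicit Defensive.

Import Order.TTheory GRing.Theory Num.Theory.
Local Open Scope ring_scope.

(* The columns of M indexed by T, in increasing order of index. *)
Definition col_subset (R : realType) (m n : nat) (M : 'M[R]_(m, n))
    (T : {set 'I_n}) : 'M[R]_(m, #|T|) :=
  colsub (fun j : 'I_#|T| => enum_val j) M.

(* Meaningful only when the selected columns are linearly independent: invmx is
   the identity function on singular matrices. For T = set0 the factors have
   inner dimension 0, so the product is 0. *)
Definition col_proj (R : realType) (m n : nat) (M : 'M[R]_(m, n))
    (T : {set 'I_n}) : 'M[R]_m :=
  let MT := col_subset M T in MT *m invmx (MT^T *m MT) *m MT^T.

(* The normed-module norm on matrices in MathComp-Analysis is the max norm. *)
Definition frobenius_norm (R : realType) (m n : nat) (M : 'M[R]_(m, n)) : R :=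
  Num.sqrt (\sum_(i < m) \sum_(j < n) M i j ^+ 2).

Definition css_criterion (R : realType) (m n r : nat) (A : 'M[R]_(m, n))
    (B : 'M[R]_(m, r)) (T : {set 'I_n}) : R :=
  frobenius_norm (B - col_proj A T *m B) ^+ 2.

(* Main.v *)
(** Multiplying by the 0/1 diagonal matrix [set_diag T] expresses "supported on
    [T]", so linear independence of the columns of [M] indexed by [T] reads
    [M D X = 0 -> D X = 0]. The matrix [col_proj A P + col_proj E Rs] is
    symmetric, fixes the columns of [A] indexed by [S], and has its range in
    their span; these properties characterise [col_proj A S], so the two agree.
    Since [col_proj E Rs] annihilates [col_proj A P], the residual for [S] is
    [F - col_proj E Rs *m F], and the claim is Pythagoras' theorem. *)
Require Import Defs.
From mathcomp Require Import all_boot all_order all_algebra.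
From mathcomp Require Import reals.

Import Order.TTheory GRing.Theory Num.Theory.
Local Open Scope ring_scope.

Section Selection.
Set Implicit Arguments.
Unset Strict Implicit.
Variables (R : realType) (n : nat).
Implicit Types T U : {set 'I_n}.

Definition sel_mx T : 'M[R]_(n, #|T|) := col_subset 1%:M T.

Definition set_diag T : 'M[R]_n := diag_mx (\row_j (j \in T)%:R).

Lemma col_subsetE m (M : 'M[R]_(m, n)) T : col_subset M T = M *m sel_mx T.
Proof. by rewrite /sel_mx /col_subset mulmx_colsub mulmx1. Qed.

Lemma tr_set_diag T : (set_diag T)^T = set_diag T.
Proof. exact: tr_diag_mx. Qed.

Lemma set_diagM T U : set_diag T *m set_diag U = set_diag (T :&: U).
Proof.
rewrite /set_diag mulmx_diag; congr diag_mx; apply/rowP => j.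
by rewrite !mxE inE -natrM mulnb.
Qed.

Lemma set_diag0 : set_diag set0 = 0.
Proof.
by apply/matrixP => i j; rewrite !mxE inE mul0rn.
Qed.

Lemma set_diagD T U : U \subset T -> set_diag T = set_diag U + set_diag (T :\: U).
Proof.
move=> /subsetP sUT; rewrite /set_diag -raddfD; congr diag_mx; apply/rowP => j.
rewrite !mxE inE; case: (boolP (j \in U)) => [/sUT -> | _] /=.
  by rewrite addr0.
by rewrite add0r.
Qed.

Lemma sel_mx_tr T : sel_mx T *m (sel_mx T)^T = set_diag T.
Proof.
apply/matrixP => i j; rewrite !mxE.
under eq_bigr => k _ do rewrite !mxE.
(* The sum over positions becomes a sum over members [l] of [T]; only [l = i] can contribute. *)
rewrite -(big_enum_val (A := mem T) (fun l => (i == l)%:R * (j == l)%:R)) /=.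
have [iT|iT] := boolP (i \in T).
  rewrite (bigD1 i) //= big1 ?addr0 ?eqxx ?mul1r 1?eq_sym //.
  by move=> k /andP[_ /negPf]; rewrite eq_sym => ->; rewrite mul0r.
rewrite mul0rn big1 // => k kT; have /negPf-> : i != k.
  by apply: contraNneq iT => ->.
by rewrite mul0r.
Qed.

Lemma tr_sel_mx T : (sel_mx T)^T *m sel_mx T = 1%:M.
Proof.
apply/matrixP => i j; rewrite !mxE (bigD1 (enum_val i)) //= !mxE eqxx mul1r.
rewrite (inj_eq enum_val_inj) big1 ?addr0 // => k /negPf nk.
by rewrite !mxE nk mul0r.
Qed.

End Selection.

Section Projection.
Set Implicit Arguments.
Unset Strict Implicit.
Variables (R : realType).

(** With [n] by [n] masks, subsets of [T] are compared without reindexing between the types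
    ['I_#|T|]. *)
Definition cols_free m n (M : 'M[R]_(m, n)) (T : {set 'I_n}) :=
  forall p (X : 'M[R]_(n, p)), M *m (set_diag R T *m X) = 0 -> set_diag R T *m X = 0.

(** Since [set_diag T] factors through [sel_mx T], the hypothesis is a relation among the selected
    columns; after transposition the row-free factor cancels. *)
Lemma row_free_cols_free m n (M : 'M[R]_(m, n)) (T : {set 'I_n}) :
  row_free (col_subset M T)^T -> cols_free M T.
Proof.
move=> frM p X; rewrite -sel_mx_tr -mulmxA mulmxA -col_subsetE => /(congr1 trmx).
rewrite trmx_mul trmx0 => /(canRL (mulmxKp frM)); rewrite mul0mx.
by move/(congr1 trmx); rewrite trmxK trmx0 => ->; rewrite mulmx0.
Qed.

Lemma cols_freeS m n (M : 'M[R]_(m, n)) (T U : {set 'I_n}) :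
  U \subset T -> cols_free M T -> cols_free M U.
Proof.
move=> /setIidPr sUT frT p X.
by rewrite -{1 2}sUT -set_diagM -mulmxA; apply: frT.
Qed.

Lemma mxtrace_tr_mul m n (M : 'M[R]_(m, n)) :
  \tr (M^T *m M) = \sum_(i < m) \sum_(j < n) M i j ^+ 2.
Proof.
rewrite exchange_big /mxtrace /=; apply: eq_bigr => j _; rewrite mxE.
by apply: eq_bigr => i _; rewrite mxE expr2.
Qed.

Lemma frobenius_norm_sqr m n (M : 'M[R]_(m, n)) :
  frobenius_norm M ^+ 2 = \tr (M^T *m M).
Proof.
rewrite mxtrace_tr_mul sqr_sqrtr //.
by apply: sumr_ge0 => i _; apply: sumr_ge0 => j _; apply: sqr_ge0.
Qed.

Lemma tr_mul_eq0 m n (M : 'M[R]_(m, n)) : M^T *m M = 0 -> M = 0.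
Proof.
move=> /(congr1 mxtrace); rewrite mxtrace_tr_mul mxtrace0 => /eqP.
rewrite psumr_eq0 => [/allP M0|i _]; last by apply: sumr_ge0 => j _; apply: sqr_ge0.
apply/matrixP => i j; have := M0 i (mem_index_enum i).
rewrite psumr_eq0 => [/allP/(_ j (mem_index_enum j))|k _]; last exact: sqr_ge0.
by rewrite /= sqrf_eq0 => /eqP ->; rewrite mxE.
Qed.

(** If [K] is the left kernel of the Gram matrix, then [MT *m K^T] has zero Gram matrix, so it
    vanishes, and freeness forces [K = 0]. *)
Lemma gram_unit m n (M : 'M[R]_(m, n)) (T : {set 'I_n}) : cols_free M T ->
  (col_subset M T)^T *m col_subset M T \in unitmx.
Proof.
move=> frM; rewrite -row_free_unit -kermx_eq0; apply/eqP.
set MT := col_subset M T; set K := kermx _.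
have KG : K *m (MT^T *m MT) = 0 by apply: mulmx_ker.
have /tr_mul_eq0 : (MT *m K^T)^T *m (MT *m K^T) = 0.
  by rewrite trmx_mul trmxK !mulmxA -(mulmxA K) KG mul0mx.
have selK : sel_mx R T *m K^T = set_diag R T *m (sel_mx R T *m K^T).
  by rewrite -sel_mx_tr mulmxA -(mulmxA _ _ (sel_mx R T)) tr_sel_mx mulmx1.
rewrite /MT col_subsetE -mulmxA selK => /frM; rewrite -selK.
move=> /(congr1 (mulmx (sel_mx R T)^T)).
rewrite mulmxA tr_sel_mx mul1mx mulmx0 => /(congr1 trmx).
by rewrite trmxK trmx0.
Qed.

Lemma tr_col_proj m n (M : 'M[R]_(m, n)) (T : {set 'I_n}) :
  (col_proj M T)^T = col_proj M T.
Proof.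
by rewrite /col_proj /= !trmx_mul trmx_inv trmx_mul !trmxK mulmxA.
Qed.

Lemma col_proj_id m n (M : 'M[R]_(m, n)) (T : {set 'I_n}) : cols_free M T ->
  col_proj M T *m (M *m set_diag R T) = M *m set_diag R T.
Proof.
move=> /gram_unit uG; rewrite -sel_mx_tr !(mulmxA M) -col_subsetE mulmxA.
by congr (_ *m _); rewrite /col_proj /= -2!mulmxA mulVmx // mulmx1.
Qed.

Lemma col_proj_range m n (M : 'M[R]_(m, n)) (T : {set 'I_n}) :
  exists X, col_proj M T = M *m set_diag R T *m X.
Proof.
rewrite /col_proj /=; set G := invmx _.
(* The leading [sel_mx R T] turns [M *m set_diag R T] into [col_subset M T]. *)
exists (sel_mx R T *m G *m (col_subset M T)^T).
rewrite -sel_mx_tr !mulmxA -(mulmxA (M *m _) _ (sel_mx R T)) tr_sel_mx mulmx1.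
by rewrite -col_subsetE.
Qed.

(** Each matrix fixes the range of the other, so [Q2 *m Q1 = Q1] and [Q1 *m Q2 = Q2]; transposing
    the first gives [Q1 *m Q2 = Q1]. *)
Lemma orth_proj_unique m p (N : 'M[R]_(m, p)) (Q1 Q2 : 'M[R]_m) :
    Q1^T = Q1 -> Q2^T = Q2 -> Q1 *m N = N -> Q2 *m N = N ->
    (exists X, Q1 = N *m X) -> (exists X, Q2 = N *m X) ->
  Q1 = Q2.
Proof.
move=> s1 s2 f1 f2 [X1 e1] [X2 e2].
have e21 : Q2 *m Q1 = Q1 by rewrite e1 mulmxA f2.
have e12 : Q1 *m Q2 = Q2 by rewrite e2 mulmxA f1.
by rewrite -s1 -e21 trmx_mul s1 s2 e12.
Qed.

Lemma col_proj_idem m n (M : 'M[R]_(m, n)) (T : {set 'I_n}) : cols_free M T ->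
  col_proj M T *m col_proj M T = col_proj M T.
Proof.
move=> frM; have [X e] := col_proj_range M T.
by rewrite {2}e mulmxA col_proj_id -?e.
Qed.

End Projection.

Section Residual.
Set Implicit Arguments.
Unset Strict Implicit.
Variables (R : realType) (m n : nat) (A : 'M[R]_(m, n)) (S P : {set 'I_n}).
Hypotheses (frS : cols_free A S) (sPS : P \subset S).
Let E := A - col_proj A P *m A.
Let D := set_diag R (S :\: P).

Let frP : cols_free A P. Proof. exact: cols_freeS sPS frS. Qed.

Let DP_D : set_diag R P *m D = 0.
Proof. by rewrite set_diagM setIDA setIC -setIDA setDv setI0 set_diag0. Qed.

(** If [E *m (D *m X) = 0], then [A *m (D *m X)] is a combination of the columns in [P]. Freeness on
    [S] equates the coefficients, and the supports [S :\: P] and [P] are disjoint. *)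
Lemma residual_cols_free : cols_free E (S :\: P).
Proof.
move=> p X; rewrite -/D mulmxBl => /eqP; rewrite subr_eq0 => /eqP.
have [Y ->] := col_proj_range A P; rewrite -!mulmxA.
set Z := Y *m _ => e.
have DS_D : set_diag R S *m D = D.
  by rewrite set_diagM setIDA setIid.
have DS_P : set_diag R S *m set_diag R P = set_diag R P.
  by rewrite set_diagM; move/setIidPr: sPS => ->.
have /frS : A *m (set_diag R S *m (D *m X - set_diag R P *m Z)) = 0.
  by rewrite mulmxBr !(mulmxA (set_diag R S)) DS_D DS_P mulmxBr e subrr.
rewrite mulmxBr !(mulmxA (set_diag R S)) DS_D DS_P => /eqP.
rewrite subr_eq0 => /eqP dXZ.
have DD : D *m D = D by rewrite set_diagM setIid.
have D_DP : D *m set_diag R P = 0.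
  by rewrite -[LHS]trmxK trmx_mul !tr_set_diag DP_D trmx0.
by rewrite -DD -mulmxA dXZ mulmxA D_DP mul0mx.
Qed.

(** By idempotence [col_proj A P] kills [E], hence the range of [col_proj E (S :\: P)]; symmetry
    swaps the factors. *)
Lemma residual_proj_orth : col_proj E (S :\: P) *m col_proj A P = 0.
Proof.
have [X e] := col_proj_range E (S :\: P).
apply: trmx_inj; rewrite trmx_mul !tr_col_proj trmx0 e !mulmxA mulmxBr mulmxA.
by rewrite col_proj_idem // subrr !mul0mx.
Qed.

Lemma col_projD : col_proj A S = col_proj A P + col_proj E (S :\: P).
Proof.
set Q := col_proj E _; set QP := col_proj A P.
have QQP : Q *m QP = 0 := residual_proj_orth.
have DS : set_diag R S = set_diag R P + D by exact: set_diagD.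
have DS_U (U : {set _}) : U \subset S -> set_diag R S *m set_diag R U = set_diag R U.
  by rewrite set_diagM => /setIidPr ->.
apply: (@orth_proj_unique _ _ _ (A *m set_diag R S)).
- exact: tr_col_proj.
- by rewrite raddfD /= !tr_col_proj.
- exact: col_proj_id.
- rewrite {1}DS mulmxDl !mulmxDr col_proj_id // DS mulmxDr.
  have -> : Q *m (A *m set_diag R P) = 0.
    by rewrite -(col_proj_id frP) mulmxA QQP mul0mx.
  (* [A] and [E] differ by [QP *m A], which [Q] kills, and [Q] fixes [E *m D]. *)
  have -> : Q *m (A *m D) = E *m D.
    rewrite -(col_proj_id residual_cols_free) -/Q -/D /E mulmxBl mulmxBr.
    by rewrite -(mulmxA QP) (mulmxA Q QP) QQP mul0mx subr0.
  by rewrite add0r mulmxBl -(mulmxA QP) -addrA subrKC.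
- exact: col_proj_range.
- have [X eX] := col_proj_range A P; have [Y eY] := col_proj_range E (S :\: P).
  (* Expand [Q = E *m D *m Y] with [E = A - QP *m A] and [QP = A *m set_diag R P *m X], then collect
     the coefficients on [P] and on [S :\: P]. *)
  exists (set_diag R P *m (X - X *m A *m D *m Y) + D *m Y).
  rewrite mulmxDr !(mulmxA (A *m _)) -!(mulmxA A (set_diag R S)).
  rewrite !DS_U ?subsetDl //.
  rewrite mulmxBr !mulmxA -eX /Q eY /E !mulmxBl -/QP -/D.
  by rewrite addrA addrAC.
Qed.

End Residual.

Theorem theorem2 (R : realType) (m n r : nat)
    (A : 'M[R]_(m, n)) (B : 'M[R]_(m, r)) (S : {set 'I_n})
    (hS : row_free (col_subset A S)^T)
    (P : {set 'I_n}) (hPS : P \subset S) :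
  let Rs := S :\: P in
  let E := A - col_proj A P *m A in
  let F := B - col_proj A P *m B in
  css_criterion A B S =
    css_criterion A B P - frobenius_norm (col_proj E Rs *m F) ^+ 2.
Proof.
move=> Rs E F; have frS := row_free_cols_free hS.
have frE : cols_free E Rs := residual_cols_free frS hPS.
rewrite /css_criterion -/F; set Q := col_proj E Rs.
(* As [Q] kills [col_proj A P], [Q *m B = Q *m F]. *)
have -> : B - col_proj A S *m B = F - Q *m F.
  rewrite (col_projD frS hPS) -/E -/Rs -/Q mulmxDl opprD addrA /F mulmxBr mulmxA.
  by rewrite (residual_proj_orth frS hPS) mul0mx subr0.
have sQ : Q^T = Q := tr_col_proj E Rs.
have QQ : Q *m (Q *m F) = Q *m F by rewrite mulmxA col_proj_idem.
(* Pythagoras holds already for the Gram matrices, before taking traces: all cross terms equal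
   [F^T *m (Q *m F)]. *)
clearbody F; rewrite !frobenius_norm_sqr -raddfB /=; congr (\tr _).
rewrite [(F - _)^T]raddfB /= trmx_mul sQ mulmxBl !mulmxBr -!(mulmxA F^T) QQ.
by rewrite subrr subr0.
Qed.
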